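(* Let $(M^3,g)$ be a balanced Hermitian manifold of complex dimension $3$. Then for any $p\in M^3$, there exists a unitary frame $\{e_1,e_2,e_3\}$ of type $(1,0)$ tangent vectors in a neighborhood of $p$ such that $T^1_{1k}=T^2_{2k}=T^3_{3k}=0$ for any $1\leq k\leq 3$, where $T^j_{ik}$ are the components under this frame of the torsion tensor of the Chern connection.
   Context: A Hermitian manifold $(M^n,g)$ is a complex manifold of complex dimension $n$ with almost complex structure $J$ and a Hermitian metric $g=\langle\,,\,\rangle$, extended bilinearly over $\mathbb{C}$. It is balanced if its K\''ahler form $\omega$ satisfies $d(\omega^{n-1})=0$. The Chern connection $\nabla$ is the unique connection with $\nabla g=0$, $\nabla J=0$ whose torsion $T(x,y)=\nabla_xy-\nabla_yx-[x,y]$ (extended linearly over $\mathbb{C}$) satisfies $T(X,\overline{Y})=0$ for all $X,Y$ of type $(1,0)$. A frame $\{e_1,\ldots,e_n\}$ of type $(1,0)$ tangent vectors is unitary if $\langle e_i,\overline{e_j}\rangle=\delta_{ij}$. The torsion components under such a frame are defined by $T(e_i,e_k)=\sum_{j=1}^n T^j_{ik}e_j$.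
   Formalization: The unitary frame is not required to be smooth or even continuous in the point: at each point near p a unitary (1,0) basis with the stated vanishing is given. With a continuous frame the claim fails, e.g. on C^3 for a diagonal balanced metric. *)

(* Defs.v *)
From HB Require Import structures.
From mathcomp Require Import all_boot all_order all_algebra all_fingroup.
From mathcomp Require Import all_classical all_reals all_analysis.
From mathcomp Require Import complex.

Set Implicit Arguments.
Unset Strict Implicit.
Unset Printing Implicit Defensive.

Import Order.TTheory GRing.Theory Num.Theory.
Import numFieldNormedType.Exports.

Local Open Scope classical_set_scope.
Local Open Scope ring_scope.

(** Smooth and holomorphic maps.  C^n is R^(n + n), (x, y) standing for
    x + i y. *)

Fixpoint Ck_on (R : realType) (m k : nat) (U : set 'rV[R]_m)
    (f : 'rV[R]_m -> R) : Prop :=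
  if k is k'.+1 then
    (forall x, U x -> differentiable f x) /\
    (forall v : 'rV[R]_m, Ck_on k' U (fun x => 'D_v f x))
  else forall x, U x -> {for x, continuous f}.

Definition smooth_on (R : realType) (m : nat) (U : set 'rV[R]_m)
    (f : 'rV[R]_m -> R) : Prop :=
  forall k, Ck_on k U f.

(* Multiplication by i, acting on row vectors on the right: (x, y) |-> (-y, x). *)
Definition Jmx (R : realType) (n : nat) : 'M[R]_(n + n) :=
  block_mx 0 1%:M (- 1%:M) 0.

(* The second clause is the Cauchy-Riemann system. *)
Definition holomorphic_on (R : realType) (n : nat) (U : set 'rV[R]_(n + n))
    (F : 'rV[R]_(n + n) -> 'rV[R]_(n + n)) : Prop :=
  (forall k, smooth_on U (fun x => F x ord0 k)) /\
  (forall x, U x -> forall v, 'D_(v *m Jmx R n) F x = 'D_v F x *m Jmx R n).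

(** [chart_map i] and [chart_inv i] are total functions, but only their
    restrictions to [chart_dom i] and to its image are meaningful.  The choice
    [chart_at] of a chart around each point is what gives coordinates to
    tangent vectors: see below. *)
Record complex_manifold (R : realType) (n : nat) := ComplexManifold {
  points :> topologicalType;
  points_hausdorff : hausdorff_space points;
  points_second_countable : @second_countable points;
  chart : Type;
  chart_dom : chart -> set points;
  chart_map : chart -> points -> 'rV[R]_(n + n);
  chart_inv : chart -> 'rV[R]_(n + n) -> points;
  open_chart_dom : forall i, open (chart_dom i);
  open_chart_img : forall i, open (chart_map i @` chart_dom i);
  chart_mapK : forall i x, chart_dom i x -> chart_inv i (chart_map i x) = x;
  chart_map_continuous : forall i x, chart_dom i x ->
    {for x, continuous (chart_map i)};
  chart_inv_continuous : forall i u, (chart_map i @` chart_dom i) u ->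
    {for u, continuous (chart_inv i)};
  chart_holomorphic : forall i j,
    holomorphic_on (chart_map i @` (chart_dom i `&` chart_dom j))
      (chart_map j \o chart_inv i);
  chart_at : points -> chart;
  chart_atP : forall x, chart_dom (chart_at x) x }.

Definition smooth_at (R : realType) (n : nat) (M : complex_manifold R n)
    (p : M) (f : M -> R) : Prop :=
  exists2 U : set 'rV[R]_(n + n),
    open_nbhs (chart_map (chart_at p) p) U &
    smooth_on U (f \o chart_inv (chart_at p)).

(** Every real tangent space T_q M is 'rV[R]_(n + n): a vector v stands for the
    tangent vector whose coordinates in the chart [chart_at q] are v.  A vector
    field is a function M -> 'rV[R]_(n + n); since [chart_at q] may jump with q,
    smoothness is that of the components in a fixed chart ([coord]), not
    of this function. *)

(* The derivative v(f) of f along v in T_q M. *)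
Definition act (R : realType) (n : nat) (M : complex_manifold R n)
    (q : M) (v : 'rV[R]_(n + n)) (f : M -> R) : R :=
  'D_v (f \o chart_inv (chart_at q)) (chart_map (chart_at q) q).

(* The coordinates of v in T_q M in the chart i. *)
Definition coord (R : realType) (n : nat) (M : complex_manifold R n)
    (i : chart M) (q : M) (v : 'rV[R]_(n + n)) : 'rV[R]_(n + n) :=
  \row_k act q v (fun y => chart_map i y ord0 k).

Definition smooth_field (R : realType) (n : nat) (M : complex_manifold R n)
    (p : M) (X : M -> 'rV[R]_(n + n)) : Prop :=
  forall k, smooth_at p (fun q => coord (chart_at p) q (X q) ord0 k).

(* The components of [X, Y] at q are X(Y(x_k)) - Y(X(x_k)), where the x_k are
   the coordinates of the chart [chart_at q]. *)
Definition bracket (R : realType) (n : nat) (M : complex_manifold R n)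
    (X Y : M -> 'rV[R]_(n + n)) (q : M) : 'rV[R]_(n + n) :=
  \row_k (let x := fun y : M => chart_map (chart_at q) y ord0 k in
          act q (X q) (fun y => act y (Y y) x) -
          act q (Y q) (fun y => act y (X y) x)).

(** Differential forms. *)

Definition form (R : realType) (n : nat) (M : complex_manifold R n) (k : nat) :=
  M -> ('I_k -> 'rV[R]_(n + n)) -> R.

Definition wedge (R : realType) (n : nat) (M : complex_manifold R n) (k l : nat)
    (a : form M k) (b : form M l) : form M (k + l) :=
  fun q v => (k`!%:R * l`!%:R)^-1 *
    \sum_(s : 'S_(k + l)) (-1) ^+ s *
      (a q (fun r => v (s (lshift l r))) * b q (fun r => v (s (rshift k r)))).

Fixpoint wedge_pow (R : realType) (n : nat) (M : complex_manifold R n)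
    (a : form M 2) (m : nat) : form M (m * 2) :=
  if m is m'.+1 then wedge a (@wedge_pow R n M a m') else fun _ _ => 1.

(* For an alternating form this is the invariant formula for (da)(X_0, ..., X_k):
     sum_i (-1)^i X_i (a (.., ^X_i, ..))
     + sum_(i < j) (-1)^(i + j) a ([X_i, X_j], .., ^X_i, .., ^X_j, ..).
   In the second sum j = lift i r with i <= r, and the bracket has been moved to
   the place of X_j, the r-th one once X_i is removed: r transpositions turn
   the sign (-1)^(i + r + 1) into (-1)^(i + 1). *)
Definition ext_der (R : realType) (n : nat) (M : complex_manifold R n) (k : nat)
    (a : form M k) (X : 'I_k.+1 -> M -> 'rV[R]_(n + n)) (q : M) : R :=
  \sum_(i < k.+1) (-1) ^+ i *
    (act q (X i q) (fun y => a y (fun r => X (lift i r) y)) -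
     \sum_(r < k | (i <= r)%N)
       a q (fun s => if s == r then bracket (X i) (X (lift i r)) q
                     else X (lift i s) q)).

Definition closed_form (R : realType) (n : nat) (M : complex_manifold R n)
    (k : nat) (a : form M k) : Prop :=
  forall (p : M) (X : 'I_k.+1 -> M -> 'rV[R]_(n + n)),
    (forall i, smooth_field p (X i)) -> ext_der a X p = 0.

(** Hermitian manifolds.  [metric q] is the Gram matrix of g on T_q M.  The
    almost complex structure of T_q M is v |-> v *m Jmx R n; it does not depend on
    the chart because the charts are holomorphically compatible. *)

Definition pairing (K : pzRingType) (m : nat) (G : 'M[K]_m) (u v : 'rV[K]_m) : K :=
  (u *m G *m v^T) ord0 ord0.

Record hermitian_manifold (R : realType) (n : nat) := HermitianManifold {
  underlying :> complex_manifold R n;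
  metric : underlying -> 'M[R]_(n + n);
  metric_sym : forall q u v, pairing (metric q) u v = pairing (metric q) v u;
  metric_pos : forall q v, v != 0 -> 0 < pairing (metric q) v v;
  metric_J : forall q u v,
    pairing (metric q) (u *m Jmx R n) (v *m Jmx R n) = pairing (metric q) u v;
  metric_smooth : forall p X Y, smooth_field p X -> smooth_field p Y ->
    smooth_at p (fun q => pairing (metric q) (X q) (Y q)) }.

Definition kahler_form (R : realType) (n : nat) (M : hermitian_manifold R n) :
    form M 2 :=
  fun q v => pairing (metric q) (v ord0 *m Jmx R n) (v ord_max).

Definition balanced (R : realType) (n : nat) (M : hermitian_manifold R n) : Prop :=
  closed_form (@wedge_pow R n M (@kahler_form R n M) n.-1).

(** Connections.  [nabla q x Y] is the covariant derivative of Y along x in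
    T_q M; it is only meaningful when Y is smooth near q.  The Leibniz rule makes
    it depend only on the germ of Y at q, so there is no need to restrict Y to
    open sets. *)
Definition connection (R : realType) (n : nat) (M : complex_manifold R n)
    (nabla : M -> 'rV[R]_(n + n) -> (M -> 'rV[R]_(n + n)) -> 'rV[R]_(n + n)) :
    Prop :=
  [/\ forall q (c : R) x y Y, smooth_field q Y ->
        nabla q (c *: x + y) Y = c *: nabla q x Y + nabla q y Y,
      forall q x Y Z, smooth_field q Y -> smooth_field q Z ->
        nabla q x (fun y => Y y + Z y) = nabla q x Y + nabla q x Z,
      forall q x f Y, smooth_at q f -> smooth_field q Y ->
        nabla q x (fun y => f y *: Y y) = act q x f *: Y q + f q *: nabla q x Y &
      forall q X Y, smooth_field q X -> smooth_field q Y ->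
        smooth_field q (fun y => nabla y (X y) Y)].

Definition is_torsion (R : realType) (n : nat) (M : complex_manifold R n)
    (nabla : M -> 'rV[R]_(n + n) -> (M -> 'rV[R]_(n + n)) -> 'rV[R]_(n + n))
    (T : M -> 'rV[R]_(n + n) -> 'rV[R]_(n + n) -> 'rV[R]_(n + n)) : Prop :=
  [/\ forall q (c : R) x y z, T q (c *: x + y) z = c *: T q x z + T q y z,
      forall q (c : R) x y z, T q z (c *: x + y) = c *: T q z x + T q z y &
      forall q X Y, smooth_field q X -> smooth_field q Y ->
        T q (X q) (Y q) =
          nabla q (X q) Y - nabla q (Y q) X - bracket X Y q].

(** The complexified tangent spaces 'rV[R[i]]_(n + n). *)

Definition complexify (R : realType) (m : nat) (x y : 'rV[R]_m) : 'rV[R[i]]_m :=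
  \row_k Complex (x ord0 k) (y ord0 k).

Definition re_part (R : realType) (m : nat) (z : 'rV[R[i]]_m) : 'rV[R]_m :=
  map_mx (@complex.Re R) z.

Definition im_part (R : realType) (m : nat) (z : 'rV[R[i]]_m) : 'rV[R]_m :=
  map_mx (@complex.Im R) z.

Definition conj_vec (R : realType) (m : nat) (z : 'rV[R[i]]_m) : 'rV[R[i]]_m :=
  map_mx (@conjc R) z.

Definition bilin_ext (R : realType) (m : nat)
    (B : 'rV[R]_m -> 'rV[R]_m -> 'rV[R]_m) (z w : 'rV[R[i]]_m) : 'rV[R[i]]_m :=
  complexify (B (re_part z) (re_part w) - B (im_part z) (im_part w))
             (B (re_part z) (im_part w) + B (im_part z) (re_part w)).

Definition metricC (R : realType) (n : nat) (M : hermitian_manifold R n) (q : M)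
    (z w : 'rV[R[i]]_(n + n)) : R[i] :=
  pairing (map_mx (real_complex R) (metric q)) z w.

Definition type10 (R : realType) (n : nat) (z : 'rV[R[i]]_(n + n)) : Prop :=
  z *m map_mx (real_complex R) (Jmx R n) = Complex 0 1 *: z.

(* [nabla] is the Chern connection of M and [T] is its torsion. *)
Definition chern_connection (R : realType) (n : nat) (M : hermitian_manifold R n)
    (nabla : M -> 'rV[R]_(n + n) -> (M -> 'rV[R]_(n + n)) -> 'rV[R]_(n + n))
    (T : M -> 'rV[R]_(n + n) -> 'rV[R]_(n + n) -> 'rV[R]_(n + n)) : Prop :=
  connection nabla /\ is_torsion nabla T /\
  [/\ forall q x Y Z, smooth_field q Y -> smooth_field q Z ->
        act q x (fun y => pairing (metric y) (Y y) (Z y)) =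
          pairing (metric q) (nabla q x Y) (Z q) +
          pairing (metric q) (Y q) (nabla q x Z),
      forall q x Y, smooth_field q Y ->
        nabla q x (fun y => Y y *m Jmx R n) = nabla q x Y *m Jmx R n &
      forall q z w, type10 z -> type10 w ->
        bilin_ext (T q) z (conj_vec w) = 0].

(* A unitary frame of type (1,0) tangent vectors at each point of U.  No
   regularity in q is part of this notion.  Unitary frames can be chosen smooth,
   but those adapted to the torsion cannot, not even continuous: the metric on
   C^3 with Kaehler form
     i (b^(1/2) dz1 dz1bar + b^(-1/2) dz2 dz2bar + b^(1/2) dz3 dz3bar),
   b = 1 + 2 (|z1|^2 + |z3|^2), is balanced; in the frame got by normalising the
   d/dz_j, T^j_(ik) = sum_l eps_(ikl) S^(jl) with
   S = conj(z3) (E12 + E21) - conj(z1) (E23 + E32) + O(|z|^2).  The condition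
   T^j_(jk) = 0 says that S is diagonal, a unitary change of frame acts on S by
   unitary congruence (up to a phase), and a continuous frame would diagonalise
   E12 + E21 and E23 + E32 simultaneously, which is impossible. *)
Definition unitary_frame (R : realType) (n : nat) (M : hermitian_manifold R n)
    (U : set M) (e : M -> 'I_n -> 'rV[R[i]]_(n + n)) : Prop :=
  forall q, U q ->
    (forall i, type10 (e q i)) /\
    (forall i j, metricC q (e q i) (conj_vec (e q j)) = (i == j)%:R).

(* [t q j i k] is the component T^j_(ik) at q. *)
Definition torsion_components (R : realType) (n : nat)
    (M : hermitian_manifold R n)
    (T : M -> 'rV[R]_(n + n) -> 'rV[R]_(n + n) -> 'rV[R]_(n + n))
    (U : set M) (e : M -> 'I_n -> 'rV[R[i]]_(n + n))
    (t : M -> 'I_n -> 'I_n -> 'I_n -> R[i]) : Prop :=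
  forall q, U q -> forall i k,
    bilin_ext (T q) (e q i) (e q k) = \sum_(j < n) t q j i k *: e q j.

(* Main.v *)
From mathcomp Require Import all_boot all_order all_algebra all_fingroup.
From mathcomp Require Import all_classical all_reals all_analysis.
From mathcomp Require Import complex ring.
Require Import Defs.

(** In dimension 3 the torsion of type (1,0) vectors is an alternating bilinear
    map from C^3 to C^3, so the cross product turns it into a 3 x 3 matrix S:
    T^j_(ik) = sum_l eps_(ikl) S_(jl).  Two facts about S give the theorem.

    S is symmetric exactly when the trace form k |-> sum_i T^i_(ik) vanishes,
    and this is what balanced means.  To see it ([balanced_trace]), evaluate
    d(omega^2) on vectors x, a, Ja, b, Jb where the complex lines of x, a, b
    are orthogonal.  Since d(omega^2) = 2 omega /\ d omega, only the two terms
    omega(a, Ja) d omega(x, b, Jb) and omega(b, Jb) d omega(x, a, Ja) survive,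
    and for the Chern connection d omega(x, a, Ja) = 2 <T(x, a), a>.  Taking x
    in the third line of a unitary frame gives the real part of the trace, and
    Jx the imaginary part.

    The condition T^j_(jk) = 0 for all j, k says that S is diagonal.  A unitary
    change of frame U replaces S by d conj(U) S U^t* with d a number of
    modulus 1, because the cross product of two rows of U is d times the
    conjugate of the third row ([cross_unitary]).  By Takagi's factorization
    ([takagi]) a complex symmetric matrix becomes diagonal under some such
    change.

    All this is done one point at a time, and the frame is then chosen
    independently at each point.  The differential geometry is carried by the
    coordinate fields of one chart ([coord_field]): they extend every tangent
    vector at p, their brackets vanish at p, and they commute with J.  So at p
    the connection is described by Gamma(x, v) = nabla_x X_v, with
    T(x, y) = Gamma(x, y) - Gamma(y, x). *)

Set Implicit Arguments.
Unset Strict Implicit.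
Unset Printing Implicit Defensive.

Import Order.TTheory GRing.Theory Num.Theory.
Import numFieldNormedType.Exports.

Local Open Scope classical_set_scope.
Local Open Scope ring_scope.

Lemma double_inj (K : numFieldType) (V : lmodType K) (x y : V) :
  x + x = y + y -> x = y.
Proof.
have half z : z = 2^-1 *: (z + z) :> V.
  by rewrite -[z + z]mulr2n -(scaler_nat 2 z) scalerA mulVf ?scale1r ?pnatr_eq0.
by move=> xy; rewrite [x]half xy -half.
Qed.

Lemma eq_opp_eq0 (K : numFieldType) (V : lmodType K) (x : V) : x = - x -> x = 0.
Proof. by move=> xN; apply: (@double_inj K); rewrite {1}xN addNr addr0. Qed.

(** * Takagi's factorization *)

Section Takagi.
Local Open Scope sesquilinear_scope.
Variable C : numClosedFieldType.
Local Notation "M ^*m" := (map_mx (@Num.conj C) M) (at level 30).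

Lemma conj_mxK m n (A : 'M[C]_(m, n)) : A ^*m ^*m = A.
Proof. by apply/matrixP=> i j; rewrite !mxE conjCK. Qed.

Lemma conj_mxD m n (A B : 'M[C]_(m, n)) : (A + B) ^*m = A ^*m + B ^*m.
Proof. exact: map_mxD. Qed.

Lemma conj_mxM m n p (A : 'M[C]_(m, n)) (B : 'M[C]_(n, p)) :
  (A *m B) ^*m = A ^*m *m B ^*m.
Proof. exact: map_mxM. Qed.

Lemma conj_mxZ m n a (A : 'M[C]_(m, n)) : (a *: A) ^*m = a^* *: A ^*m.
Proof. exact: map_mxZ. Qed.

Lemma dot_ge0 n (x : 'rV[C]_n) : 0 <= (x *m x ^t*) 0 0.
Proof.
rewrite mxE sumr_ge0 // => i _; rewrite !mxE.
exact: mul_conjC_ge0.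
Qed.

Lemma dot_eq0 n (x : 'rV[C]_n) : ((x *m x ^t*) 0 0 == 0) = (x == 0).
Proof.
apply/idP/eqP=> [|->]; last by rewrite mul0mx mxE.
rewrite mxE psumr_eq0 => [/allP x0|i _]; last by rewrite !mxE mul_conjC_ge0.
apply/rowP=> i; have := x0 i (mem_index_enum _).
by rewrite !mxE mul_conjC_eq0 => /eqP.
Qed.

Lemma stable_eigenvector n p (N : 'M[C]_n) (W : 'M[C]_(n, p)) :
  (forall x : 'rV_n, x *m W = 0 -> x *m N *m W = 0) -> (p < n)%N ->
  exists (x : 'rV_n) (a : C), [/\ x != 0, x *m W = 0 & x *m N = a *: x].
Proof.
move=> stabW ltpn; set K := row_base (kermx W).
have KW : K *m W = 0 by apply/sub_kermxP; rewrite eq_row_base.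
have KNW : K *m N *m W = 0.
  apply/row_matrixP=> i; rewrite row0 -mulmxA row_mul mulmxA; apply: stabW.
  by rewrite -row_mul KW row0.
have /submxP [B KN] : (K *m N <= K)%MS.
  by rewrite /K eq_row_base; apply/sub_kermxP.
have rK : (0 < \rank (kermx W))%N.
  by rewrite mxrank_ker subn_gt0 (leq_ltn_trans (rank_leq_col W)).
have [a] := eigenvalue_closed B rK.
move=> /eigenvalueP [w wB w0]; exists (w *m K), a.
split; last by rewrite -mulmxA KN mulmxA wB -scalemxAl.
  by rewrite mulmx_free_eq0 ?row_base_free.
by rewrite -mulmxA KW mulmx0.
Qed.

(** The map x |-> conj(x) S is antilinear and its square is linear, so the square
    has an eigenvector x in any stable subspace.  Symmetry of S makes the
    eigenvalue a = |x conj(S)|^2 / |x|^2 nonnegative; with m = sqrt a, the vector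
    y = conj(x) S + m x satisfies conj(y) S = m y, and if y vanishes then x itself
    has coneigenvalue -m. *)
Lemma coneigenvector n p (S : 'M[C]_n) (W : 'M[C]_(n, p)) :
  S^T = S -> (forall x : 'rV_n, x *m W = 0 -> x ^*m *m S *m W = 0) ->
  (p < n)%N ->
  exists (x : 'rV_n) (a : C), [/\ x != 0, x *m W = 0 & x ^*m *m S = a *: x].
Proof.
move=> Ssym stabW ltpn.
have stab2 (x : 'rV_n) : x *m W = 0 -> x *m (S ^*m *m S) *m W = 0.
  move=> xW; have := stabW _ (stabW _ xW).
  by rewrite conj_mxM conj_mxK !mulmxA.
have [x [a [x0 xW xS]]] := stable_eigenvector stab2 ltpn.
have x_gt0 : 0 < (x *m x ^t*) 0 0 by rewrite lt_def dot_eq0 x0 dot_ge0.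
have a_ge0 : 0 <= a.
  rewrite -(pmulr_lge0 _ x_gt0).
  have -> : a * (x *m x ^t*) 0 0 = (x *m S ^*m *m (x *m S ^*m) ^t*) 0 0.
    rewrite trmx_mul conj_mxM map_trmx conj_mxK Ssym mulmxA.
    by rewrite -(mulmxA x) xS -scalemxAl [RHS]mxE.
  exact: dot_ge0.
set m := sqrtC a; have m_real : m^* = m.
  by apply/CrealP; rewrite realE sqrtC_ge0 a_ge0.
set y := x ^*m *m S + m *: x.
have yS : y ^*m *m S = m *: y.
  rewrite conj_mxD conj_mxM conj_mxK conj_mxZ m_real mulmxDl -mulmxA xS.
  by rewrite -scalemxAl scalerDr scalerA -expr2 sqrtCK addrC.
have [y0|y0] := eqVneq y 0; last first.
  by exists y, m; split=> //; rewrite mulmxDl -scalemxAl xW stabW // scaler0 addr0.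
exists x, (- m); split=> //.
by apply/eqP; rewrite scaleNr -addr_eq0 -/y y0.
Qed.

Lemma normalizing_factor (h : C) : 0 < h ->
  exists2 c : C, c * c^* * h = 1 & c^* = c.
Proof.
move=> h_gt0; have cC : (sqrtC h)^-1^* = (sqrtC h)^-1.
  by apply/CrealP; rewrite realE invr_ge0 sqrtC_ge0 ltW.
by exists (sqrtC h)^-1; rewrite // cC -expr2 exprVn sqrtCK mulVf ?gt_eqF.
Qed.

(** The rows of M are coneigenvectors of S; their orthogonal complement is stable
    under x |-> conj(x) S by symmetry of S, so one more can be found there. *)
Lemma takagi_partial n (S : 'M[C]_n) m : S^T = S -> (m <= n)%N ->
  exists (M : 'M[C]_(m, n)) (d : 'rV[C]_m),
    M *m M ^t* = 1%:M /\ M ^*m *m S = diag_mx d *m M.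
Proof.
move=> Ssym; elim: m => [|m IHm] lemn.
  by exists 0, 0; split; apply/matrixP=> -[].
have [M [d [MM MS]]] := IHm (ltnW lemn).
have stab (x : 'rV_n) : x *m M ^t* = 0 -> x ^*m *m S *m M ^t* = 0.
  move=> xM.
  apply: trmx_inj; rewrite trmx0.
  rewrite !trmx_mul map_trmx trmxK Ssym mulmxA MS -mulmxA.
  have -> : M *m (x ^*m)^T = ((x *m M ^t*) ^*m) ^T.
    by rewrite conj_mxM conj_mxK trmx_mul trmxK.
  by rewrite xM map_mx0 trmx0 mulmx0.
have [x [a [x0 xM xS]]] := coneigenvector Ssym stab lemn.
have [|c c1 cC] := @normalizing_factor ((x *m x ^t*) 0 0).
  by rewrite lt_def dot_eq0 x0 dot_ge0.
have PP : col_mx (c *: x) M *m (col_mx (c *: x) M) ^t* = 1%:M.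
  rewrite tr_col_mx map_row_mx mul_col_row scalar_mx_block; congr block_mx.
  - rewrite linearZ /= conj_mxZ -scalemxAr -scalemxAl scalerA [c^* * c]mulrC.
    by rewrite [x *m _]mx11_scalar scale_scalar_mx c1.
  - by rewrite -scalemxAl xM scaler0.
  - have -> : M *m (c *: x) ^t* = c^* *: (x *m M ^t*) ^t*.
      rewrite linearZ /= conj_mxZ -scalemxAr trmx_mul conj_mxM map_trmx.
      by rewrite trmxK conj_mxK.
    by rewrite xM trmx0 map_mx0 scaler0.
  - exact: MM.
have PS : (col_mx (c *: x) M) ^*m *m S =
    diag_mx (row_mx a%:M d) *m col_mx (c *: x) M.
  rewrite map_col_mx mul_col_mx diag_mx_row mul_block_col MS !mul0mx addr0 add0r.
  congr col_mx; rewrite conj_mxZ -scalemxAl xS cC -scalemxAr.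
  by congr (_ *: _); apply/rowP=> i; rewrite mul_diag_mx !mxE mulr1n.
by exists (col_mx (c *: x) M), (row_mx a%:M d).
Qed.

Theorem takagi n (S : 'M[C]_n) : S^T = S ->
  exists (U : 'M[C]_n) (d : 'rV[C]_n),
    U *m U ^t* = 1%:M /\ U ^*m *m S *m U ^t* = diag_mx d.
Proof.
move=> Ssym; have [U [d [UU US]]] := takagi_partial Ssym (leqnn n).
by exists U, d; rewrite US -mulmxA UU mulmx1.
Qed.

(** * The torsion matrix in dimension 3 *)

(** Indices live in 'I_3 = Z/3, so that n + 1 and n + 2 are the two other indices
    in cyclic order. *)
Definition cross (K : pzRingType) (u v : 'rV[K]_3) : 'rV[K]_3 :=
  \row_n (u 0 (n + 1) * v 0 (n + 2) - u 0 (n + 2) * v 0 (n + 1)).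

Lemma ord3P (P : 'I_3 -> Prop) : P 0 -> P 1 -> P 2 -> forall i, P i.
Proof.
move=> P0 P1 P2 [[|[|[|//]]] lt_i].
- by have -> : Ordinal lt_i = 0 by apply/val_inj.
- by have -> : Ordinal lt_i = 1 by apply/val_inj.
- by have -> : Ordinal lt_i = 2 by apply/val_inj.
Qed.

Lemma sum3 (V : nmodType) (F : 'I_3 -> V) : \sum_i F i = F 0 + F 1 + F 2.
Proof.
rewrite !big_ord_recr big_ord0 /= add0r.
by congr (F _ + F _ + F _); apply/val_inj.
Qed.

Let eq3 (a b : 'I_3) : a == b -> a = b. Proof. by move/eqP. Qed.

Definition ord3D := (@eq3 (0 + 1) 1 isT, @eq3 (0 + 2) 2 isT, @eq3 (1 + 1) 2 isT,
  @eq3 (1 + 2) 0 isT, @eq3 (2 + 1) 0 isT, @eq3 (2 + 2) 1 isT).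

(** The rows of the matrix X of cross products are dual to those of U, up to the
    determinant d: row i of U times row l of X is the determinant of the rows
    i, l + 1, l + 2.  Hence U X^T = d, and U^-1 is the adjoint of U. *)
Lemma cross_unitary (U : 'M[C]_3) : U *m U ^t* = 1%:M ->
  exists d, forall l : 'I_3,
    cross (row (l + 1) U) (row (l + 2) U) = d *: (row l U) ^*m.
Proof.
move=> UU; pose X := \matrix_l cross (row (l + 1) U) (row (l + 2) U).
pose d := (U *m X^T) 0 0; exists d => l.
have UX : U *m X^T = d%:M.
  by apply/matrixP; elim/ord3P; elim/ord3P;
    rewrite /d !mxE !sum3 !mxE !ord3D /=; ring.
have XE : X = d *: U ^*m.
  apply: trmx_inj; rewrite -[LHS]mul1mx -(mulmx1C UU) -mulmxA UX.
  by rewrite mul_mx_scalar linearZ /= map_trmx.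
by rewrite -(rowK (fun l => cross (row (l + 1) U) _) l) -/X XE linearZ /= map_row.
Qed.

(** Here t j i k stands for the components T^j_(ik), and the triple sum is the
    component T^j_(jk) in the frame transformed by U. *)
Lemma diagonal_torsion (t : 'I_3 -> 'I_3 -> 'I_3 -> C) :
  (forall j i k, t j k i = - t j i k) -> (forall k, \sum_i t i i k = 0) ->
  exists2 U : 'M[C]_3, U *m U ^t* = 1%:M &
    forall j k,
      \sum_a \sum_b \sum_m U j a * U k b * t m a b * (U j m)^* = 0.
Proof.
move=> t_alt t_tr; pose S := \matrix_(m, n) t m (n + 1) (n + 2).
have t_diag m a : t m a a = 0.
  have /eqP : t m a a *+ 2 = 0 by rewrite mulr2n {1}t_alt addNr.
  by rewrite mulrn_eq0 => /eqP.
have Ssym : S^T = S.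
  have e0 : t 2 0 2 = - t 1 0 1.
    apply/eqP; rewrite -subr_eq0 opprK -oppr_eq0 opprD -!t_alt addrC.
    by have := t_tr 0; rewrite sum3 t_diag add0r => ->.
  have e1 : t 2 1 2 = t 0 0 1.
    apply/eqP; rewrite eq_sym -subr_eq0 -t_alt.
    by have := t_tr 1; rewrite sum3 t_diag addr0 => ->.
  have e2 : t 1 1 2 = - t 0 0 2.
    apply/eqP; rewrite -subr_eq0 opprK addrC.
    by have := t_tr 2; rewrite sum3 t_diag addr0 => ->.
  apply/matrixP; elim/ord3P; elim/ord3P; rewrite !mxE !ord3D //;
    by rewrite ?(t_alt _ 0 1) ?(t_alt _ 0 2) ?(t_alt _ 1 2) ?e0 ?e1 ?e2 ?opprK.
have [U [e [UU US]]] := takagi Ssym; exists U => // j k.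
(* The two lower indices of t contract with two vectors through their cross
   product. *)
have tS (u v : 'rV[C]_3) m :
    \sum_a \sum_b u 0 a * v 0 b * t m a b = (S *m (cross u v)^T) m 0.
  rewrite !mxE !sum3 !mxE !ord3D !t_diag (t_alt _ 0 1) (t_alt _ 0 2) (t_alt _ 1 2).
  ring.
transitivity ((row j U ^*m *m S *m (cross (row j U) (row k U))^T) 0 0).
  rewrite -mulmxA mxE; under eq_bigr do rewrite exchange_big /=.
  rewrite exchange_big; apply: eq_bigr => m _; rewrite -tS !mxE mulrC.
  rewrite mulr_suml; apply: eq_bigr => a _; rewrite mulr_suml.
  by apply: eq_bigr => b _; rewrite !mxE.
have [d dU] := cross_unitary UU.
have diag (l : 'I_3) : l != j ->
    (row j U ^*m *m S *m (d *: (row l U) ^*m)^T) 0 0 = 0.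
  move=> lj; rewrite linearZ /= -scalemxAr mxE.
  have -> : row j U ^*m *m S *m ((row l U) ^*m)^T = row j (col l (diag_mx e)).
    rewrite -US colE -[in RHS]mulmxA -colE !row_mul map_row.
    by congr (_ *m _); apply/colP=> ?; rewrite !mxE.
  by rewrite !mxE eq_sym (negbTE lj) mulr0.
have crossC (u v : 'rV[C]_3) : cross u v = - cross v u.
  by apply/rowP=> n; rewrite !mxE; ring.
have kE : [\/ k = j, k = j + 1 | k = j + 2].
  move: j k {dU diag}; elim/ord3P; elim/ord3P; rewrite !ord3D ?add0r ?addr0;
    by constructor.
have j3 : j + 2 + 1 = j /\ j + 2 + 2 = j + 1 /\ j + 1 + 1 = j + 2 /\ j + 1 + 2 = j.
  by move: j {dU diag kE}; elim/ord3P; rewrite !ord3D ?add0r ?addr0.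
have nj : j + 2 != j /\ j + 1 != j.
  by move: j {dU diag kE j3}; elim/ord3P.
case: kE => ->.
- have -> : cross (row j U) (row j U) = 0.
    by apply/rowP=> n; rewrite !mxE; ring.
  by rewrite trmx0 mulmx0 mxE.
- have := dU (j + 2); rewrite j3.1 j3.2.1 => ->; exact/diag/nj.1.
- rewrite crossC; have := dU (j + 1); rewrite j3.2.2.1 j3.2.2.2 => ->.
  by rewrite linearN mulmxN mxE diag ?oppr0 //; apply nj.2.
Qed.
End Takagi.

(** * The square of a 2-form *)

Lemma sum_lift_perm (V : nmodType) m (F : 'S_m.+1 -> V) :
  \sum_s F s = \sum_i \sum_s F (lift_perm ord0 i s).
Proof.
rewrite pair_big /=; pose h (p : 'I_m.+1 * 'S_m) := lift_perm ord0 p.1 p.2.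
rewrite (reindex h) //; apply/onW_bij/inj_card_bij; last first.
  by rewrite card_prod card_ord !card_Sn factS.
move=> [i s] [j t]; rewrite /h /= => E.
have ij : i = j by rewrite -(lift_perm_id ord0 i s) E lift_perm_id.
congr (_, _) => //; apply/permP => k; apply: (@lift_inj _ i).
by rewrite -(lift_perm_lift ord0) E lift_perm_lift ij.
Qed.

Lemma sum_perm1 (V : nmodType) (F : 'S_1 -> V) : \sum_s F s = F 1%g.
Proof.
by rewrite (big_pred1 1%g) // => s; apply/esym/eqP/permP => k; rewrite !ord1.
Qed.

Lemma sum_perm2 (V : nmodType) (F : 'S_2 -> V) :
  \sum_s F s = \sum_(i < 2) F (lift_perm ord0 i 1%g).
Proof. by rewrite sum_lift_perm; under eq_bigr do rewrite sum_perm1. Qed.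

Lemma sum_perm4 (V : nmodType) (F : 'S_4 -> V) :
  \sum_s F s = \sum_(i < 4) \sum_(j < 3) \sum_(k < 2)
    F (lift_perm ord0 i (lift_perm ord0 j (lift_perm ord0 k 1%g))).
Proof.
rewrite sum_lift_perm; apply: eq_bigr => i _.
by rewrite sum_lift_perm; apply: eq_bigr => j _; rewrite sum_perm2.
Qed.

Section Pfaffian.
Variables (R : realType) (n : nat) (M : complex_manifold R n) (w : form M 2).
Variables (q : M) (b : 'rV[R]_(n + n) -> 'rV[R]_(n + n) -> R).
Hypotheses (wb : forall v, w q v = b (v ord0) (v ord_max))
  (bC : forall x y, b y x = - b x y).

(** The 24 permutations fall into 3 classes of 8, one for each way to split four
    vectors into two pairs, and b takes the same signed value on each class; the
    factor 2 is 8 over the normalization 2! 2! of the wedge product. *)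
Lemma wedge_pow2 (v : 'I_(2 * 2) -> 'rV[R]_(n + n))
    (x0 := v (@Ordinal (2 * 2) 0 isT)) (x1 := v (@Ordinal (2 * 2) 1 isT))
    (x2 := v (@Ordinal (2 * 2) 2 isT)) (x3 := v (@Ordinal (2 * 2) 3 isT)) :
  @wedge_pow R n M w 2 q v =
  2%:R * (b x0 x1 * b x2 x3 - b x0 x2 * b x1 x3 + b x0 x3 * b x1 x2).
Proof.
have w1 (u : 'I_(1 * 2) -> 'rV[R]_(n + n)) :
    @wedge_pow R n M w 1 q u = b (u ord0) (u ord_max).
  have u1 : u (lift ord0 ord0) = u ord_max by congr u; apply/val_inj.
  have e0 : @lshift 2 (0 * 2) ord0 = ord0 :> 'I_2 by apply/val_inj.
  have e1 : @lshift 2 (0 * 2) ord_max = lift ord0 ord0 :> 'I_2 by apply/val_inj.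
  rewrite /= /wedge /= (sum_perm2 (V := R)) !big_ord_recl big_ord0 !wb /= e0 e1.
  rewrite !lift_perm_id !lift_perm_lift !perm1 !odd_lift_perm !odd_perm1 /=.
  have -> : lift (lift ord0 ord0) ord0 = ord0 :> 'I_2 by apply/val_inj.
  rewrite u1 [b (u ord_max) _]bC.
  have -> : 2`! = 2%N by []; have -> : (0 * 2)`! = 1%N by [].
  by field.
pose f k := nth 0 [:: x0; x1; x2; x3] k.
have vE i : v i = f i.
  by case: i => [[|[|[|[|//]]]] lt_i]; rewrite /f /=; congr v; apply/val_inj.
have e0 : @lshift 2 (1 * 2) ord0 = ord0 :> 'I_4 by apply/val_inj.
have e1 : @lshift 2 (1 * 2) ord_max = lift ord0 ord0 :> 'I_4 by apply/val_inj.
have e2 : @rshift 2 (1 * 2) ord0 = lift ord0 (lift ord0 ord0) :> 'I_4.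
  by apply/val_inj.
have e3 : @rshift 2 (1 * 2) ord_max =
    lift ord0 (lift ord0 (lift ord0 ord0)) :> 'I_4 by apply/val_inj.
rewrite -[LHS]/(wedge w (@wedge_pow R n M w 1) q v) /wedge.
under eq_bigr do rewrite wb w1.
rewrite (sum_perm4 (V := R)) e0 e1 e2 e3.
under eq_bigr => i _ do under eq_bigr => j _ do under eq_bigr => k _ do
  rewrite !lift_perm_id !lift_perm_lift !lift_perm_id !perm1 !odd_lift_perm
    !odd_perm1 !vE.
rewrite !big_ord_recl !big_ord0 /= /f /=.
rewrite (bC x0 x1) (bC x0 x2) (bC x0 x3) (bC x1 x2) (bC x1 x3) (bC x2 x3).
have -> : 2`! = 2%N by [].
by field.
Qed.
End Pfaffian.

(** * Coordinate vector fields *)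

Lemma near_eq_differentiable (R : numFieldType) (V W : normedModType R)
    (f g : V -> W) (x : V) :
  (\near x, f x = g x) -> differentiable f x -> differentiable g x.
Proof.
move=> fg df; have fx : f x = g x := nbhs_singleton fg.
have fg0 : \forall h \near 0, f (h + x) = g (h + x).
  by move: fg; rewrite (near_shift 0) /= subr0.
have gE : g \o shift x = cst (g x) + 'd f x +o_ 0 id.
  have /eqaddoP fE := diff_locally df.
  apply/eqaddoP => e e0; near=> h.
  have -> : (g \o shift x - (cst (g x) + 'd f x)) h =
      (f \o shift x - (cst (f x) + 'd f x)) h.
    rewrite -[LHS]/(g (h + x) - (g x + 'd f x h)).
    rewrite -[RHS]/(f (h + x) - (f x + 'd f x h)) fx; congr (_ - _).
    by apply/esym; near: h.
  by near: h; exact: fE.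
have dg : 'd g x = 'd f x :> (V -> W).
  by apply: diff_unique gE; exact: diff_continuous.
by apply/diff_locallyP; rewrite dg; split=> //; exact: diff_continuous.
Unshelve. all: by end_near. Qed.

Section SmoothMaps.
Variable R : realType.

Lemma smooth_on_differentiable m (U : set 'rV[R]_m) f x :
  smooth_on U f -> U x -> differentiable f x.
Proof. by move=> /(_ 1%N)[+ _]; exact. Qed.

Lemma smooth_on_cst m (U : set 'rV[R]_m) f a :
  open U -> (forall x, U x -> f x = a) -> smooth_on U f.
Proof.
move=> oU; have nfa g b x : (forall x, U x -> g x = b) -> U x ->
    \near x, cst b x = g x.
  move=> gb Ux; near=> y; apply/esym/gb.
  by near: y; exact: open_nbhs_nbhs.
have dU g b x : (forall x, U x -> g x = b) -> U x -> differentiable g x.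
  move=> gb Ux; apply: (@near_eq_differentiable _ _ _ (cst b)); first exact: nfa.
  exact: differentiable_cst.
move=> + k; elim: k => [|k IHk] in f a * => fa.
  by move=> x Ux; apply: differentiable_continuous; exact: dU fa Ux.
split=> [x Ux|v]; first exact: dU fa Ux.
apply: (IHk _ 0) => x Ux.
by rewrite -(near_eq_derive v (nfa _ f a x fa Ux)) derive_cst.
Unshelve. all: by end_near. Qed.

Lemma differentiable_row m n (f : 'rV[R]_m -> 'rV[R]_n) x :
  (forall k, differentiable (fun y => f y ord0 k) x) -> differentiable f x.
Proof.
move=> df.
have -> : f = \sum_(k < n) (fun y => f y ord0 k *: delta_mx ord0 k).
  by apply/funext => y; rewrite fct_sumE; exact: row_sum_delta.
by apply: differentiable_sum => k; exact: differentiableZl.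
Qed.

Lemma derive_coord m (x v : 'rV[R]_m) k :
  'D_v (fun y : 'rV[R]_m => y ord0 k) x = v ord0 k.
Proof.
have := derive_id x v; rewrite derive_mx; last exact: derivable_id.
by move=> /(congr1 (fun w : 'rV_m => w ord0 k)); rewrite mxE.
Qed.

End SmoothMaps.

Section Charts.
Variables (R : realType) (n : nat) (M : complex_manifold R n).
Implicit Types (i j : chart M) (q : M) (v w : 'rV[R]_(n + n)).

Lemma near_chart_inv i q (P : M -> Prop) : chart_dom i q -> (\near q, P q) ->
  \forall u \near chart_map i q,
    [/\ chart_dom i (chart_inv i u), chart_map i (chart_inv i u) = u &
        P (chart_inv i u)].
Proof.
move=> iq Pq; near=> u.
have [z iz zu] : (chart_map i @` chart_dom i) u.
  by near: u; apply: open_nbhs_nbhs; split; [exact: open_chart_img|exists q].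
have zE : chart_inv i u = z by rewrite -zu chart_mapK.
split; rewrite ?zE //; rewrite -zE; near: u.
have inv_cvg : chart_inv i @ chart_map i q --> chart_inv i (chart_map i q).
  by apply: chart_inv_continuous; exists q.
by rewrite chart_mapK // in inv_cvg; exact: inv_cvg.
Unshelve. all: by end_near. Qed.

Lemma differentiable_transition i j q : chart_dom i q -> chart_dom j q ->
  differentiable (chart_map j \o chart_inv i) (chart_map i q).
Proof.
move=> iq jq; apply: differentiable_row => k.
have [/(_ k) sm _] := chart_holomorphic i j.
by apply: smooth_on_differentiable sm _; exists q.
Qed.

(** The field with constant components v in the chart i, extended by 0 outside
    the domain of i.  Tangent vectors at q are written in [chart_at q], hence the
    derivative of the transition map. *)
Definition coord_field i v q : 'rV[R]_(n + n) :=
  if `[< chart_dom i q >] then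
    'D_v (chart_map (chart_at q) \o chart_inv i) (chart_map i q)
  else 0.

Lemma coord_fieldE i v q : chart_dom i q ->
  coord i q (coord_field i v q) = v.
Proof.
move=> iq; have cq := chart_atP q; set c := chart_at q in cq *.
rewrite /coord_field asboolT // -/c; apply/rowP => k; rewrite mxE /act -/c.
set F := chart_map c \o chart_inv i; set x := chart_map i q.
set G := fun u => chart_map i (chart_inv c u) ord0 k.
have dF : differentiable F x by exact: differentiable_transition.
have Fx : F x = chart_map c q by rewrite /F /= /x chart_mapK.
have dG : differentiable G (F x).
  rewrite Fx; have [/(_ k) sm _] := chart_holomorphic c i.
  by apply: smooth_on_differentiable sm _; exists q.
rewrite -[LHS]/('D_('D_v F x) G (chart_map c q)) -Fx.
rewrite !deriveE //.
rewrite -[LHS]/(('d G (F x) \o 'd F x) v) -diff_comp // -deriveE; last first.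
  exact: differentiable_comp.
rewrite -[RHS](derive_coord x v k); apply: near_eq_derive.
have cnear : \near q, chart_dom c q.
  by apply: open_nbhs_nbhs; split => //; exact: open_chart_dom.
apply: filterS (near_chart_inv iq cnear) => u [iu uu cu].
by rewrite /G /F /= chart_mapK // uu.
Qed.

Lemma coord_field_at v q : coord_field (chart_at q) v q = v.
Proof.
have cq := chart_atP q; rewrite /coord_field asboolT //.
rewrite -[RHS](derive_id (chart_map (chart_at q) q)); apply: near_eq_derive.
by apply: filterS (near_chart_inv cq filterT) => u [_ uu _].
Qed.

(** The Cauchy-Riemann equations for the transition map. *)
Lemma coord_fieldJ i v q :
  coord_field i (v *m Jmx R n) q = coord_field i v q *m Jmx R n.
Proof.
rewrite /coord_field; case: asboolP => iq; last by rewrite mul0mx.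
have [_ hol] := chart_holomorphic i (chart_at q).
by apply: hol; exists q => //; split => //; exact: chart_atP.
Qed.

Lemma smooth_coord_field v q : smooth_field q (coord_field (chart_at q) v).
Proof.
move=> k; set i := chart_at q; exists (chart_map i @` chart_dom i).
  by split; [exact: open_chart_img|exists q => //; exact: chart_atP].
apply: (@smooth_on_cst _ _ _ _ (v ord0 k)); first exact: open_chart_img.
by move=> _ [x ix <-]; rewrite /= chart_mapK // coord_fieldE.
Qed.

(** The components of a coordinate field are constant near q. *)
Lemma act_coord_field q v w x k :
  act q x (fun y => act y (coord_field (chart_at q) w y)
    (fun z => chart_map (chart_at q) z ord0 k)) = 0.
Proof.
set i := chart_at q; rewrite /act -/i.
rewrite -[RHS](derive_cst (w ord0 k) (chart_map i q) x); apply: near_eq_derive.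
have iq := chart_atP q.
apply: filterS (near_chart_inv iq filterT) => u [iu _ _].
rewrite /= -[RHS](congr1 (fun r : 'rV_(n + n) => r ord0 k) (coord_fieldE w iu)).
by rewrite mxE.
Qed.

Lemma bracket_coord_field q v w :
  bracket (coord_field (chart_at q) v) (coord_field (chart_at q) w) q = 0.
Proof.
apply/rowP => k; rewrite mxE [RHS]mxE -[RHS](subrr 0).
by congr (_ - _); exact: act_coord_field.
Qed.

Lemma smooth_at_differentiable q f : smooth_at q f ->
  differentiable (f \o chart_inv (chart_at q)) (chart_map (chart_at q) q).
Proof. by case=> U [_ Uq] sm; exact: smooth_on_differentiable sm Uq. Qed.

End Charts.

(** * Real and complex tangent vectors *)

Section Pairing.
Variables (K : comNzRingType) (m : nat) (G : 'M[K]_m).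
Local Notation g := (pairing G).

Lemma pairingDl u v w : g (u + v) w = g u w + g v w.
Proof. by rewrite /pairing !mulmxDl mxE. Qed.

Lemma pairingNl v w : g (- v) w = - g v w.
Proof. by rewrite /pairing !mulNmx mxE. Qed.

Lemma pairingNr v w : g w (- v) = - g w v.
Proof. by rewrite /pairing linearN mulmxN mxE. Qed.

Lemma pairing0l w : g 0 w = 0.
Proof. by rewrite /pairing !mul0mx mxE. Qed.

Lemma pairing0r w : g w 0 = 0.
Proof. by rewrite /pairing trmx0 mulmx0 mxE. Qed.
End Pairing.

Lemma mulJJ (R : realType) m n (A : 'M[R]_(m, n + n)) :
  A *m Jmx R n *m Jmx R n = - A.
Proof.
rewrite -mulmxA mulmx_block !mul0mx !mulmx0 !mulmxN !mulNmx !mul1mx !addr0 !add0r.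
have -> : block_mx (- 1%:M) 0 0 (- 1%:M) = - 1%:M :> 'M[R]_(n + n).
  by rewrite [in RHS]scalar_mx_block opp_block_mx oppr0.
by rewrite mulmxN mulmx1.
Qed.

Section Complexify.
Variables (R : realType) (m : nat).
Implicit Types x y : 'rV[R]_m.

Lemma re_complexify x y : re_part (complexify x y) = x.
Proof. by apply/rowP => k; rewrite !mxE. Qed.

Lemma im_complexify x y : im_part (complexify x y) = y.
Proof. by apply/rowP => k; rewrite !mxE. Qed.

Lemma conj_complexify x y : conj_vec (complexify x y) = complexify x (- y).
Proof. by apply/rowP => k; rewrite !mxE. Qed.

Lemma complexify0 x y : complexify x y = 0 -> x = 0 /\ y = 0.
Proof.
by move=> /rowP xy0; split; apply/rowP => k; have := xy0 k; rewrite !mxE => -[].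
Qed.
End Complexify.

Section Part10.
Local Open Scope complex_scope.
Variables (R : realType) (n : nat).
Local Notation J := (Jmx R n).

(** x - i J x, twice the (1,0)-part of the real vector x. *)
Definition part10 (x : 'rV[R]_(n + n)) := complexify x (- (x *m J)).

Lemma part10E x : part10 x = map_mx (real_complex R) x
  - Complex 0 1 *: (map_mx (real_complex R) x *m map_mx (real_complex R) J).
Proof. by rewrite -map_mxM; apply/rowP => k; rewrite !mxE; simpc. Qed.

Lemma type10_part10 x : type10 (part10 x).
Proof.
rewrite /type10 part10E mulmxBl -scalemxAl -!map_mxM mulJJ map_mxN scalerN opprK.
by rewrite scalerBr scalerA -expr2 sqr_i scaleN1r opprK addrC.
Qed.

Lemma type10_re z : type10 z -> z = part10 (re_part z).
Proof.
move=> zJ; have zE : z = complexify (re_part z) (im_part z).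
  by apply/rowP => k; rewrite !mxE; case: (z 0 k).
rewrite [LHS]zE; congr complexify; apply/rowP => k.
have := congr1 (fun w : 'rV[R[i]]_(n + n) => complex.Re (w 0 k)) zJ.
rewrite !mxE mulrC ReiNIm raddf_sum /= => zJk.
rewrite -[LHS]opprK -zJk; congr (- _).
apply: eq_bigr => j _; rewrite !mxE.
by case: (z 0 j) => a b; simpc.
Qed.

Lemma row_part10 m (F : 'M[R[i]]_(m, n + n)) i :
  F *m map_mx (real_complex R) J = 'i *: F ->
  row i F = part10 (re_part (row i F)).
Proof. by move=> FJ; apply: type10_re; rewrite /type10 -row_mul FJ linearZ. Qed.

End Part10.

(** * The Chern torsion of a balanced metric *)

Lemma derive_pfaffian (R : realType) (V : normedModType R)
    (f01 f23 f02 f13 f03 f12 : V -> R) (d01 d23 d02 d13 d03 d12 : R) (x v : V) :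
  is_derive x v f01 d01 -> is_derive x v f23 d23 -> is_derive x v f02 d02 ->
  is_derive x v f13 d13 -> is_derive x v f03 d03 -> is_derive x v f12 d12 ->
  'D_v (fun y => 2%:R * (f01 y * f23 y - f02 y * f13 y + f03 y * f12 y)) x =
  2%:R * (f01 x * d23 + d01 * f23 x - (f02 x * d13 + d02 * f13 x)
    + (f03 x * d12 + d03 * f12 x)).
Proof.
move=> i01 i23 i02 i13 i03 i12.
have D := is_deriveZ 2%:R (is_deriveD
  (is_deriveB (is_deriveM i01 i23) (is_deriveM i02 i13)) (is_deriveM i03 i12)).
by apply: etrans (@derive_val _ _ _ _ _ _ _ D) _; rewrite /GRing.scale /=; ring.
Qed.

Section Chern.
Variables (R : realType) (n : nat) (M : hermitian_manifold R n).
Variables (nabla : M -> 'rV[R]_(n + n) -> (M -> 'rV[R]_(n + n)) -> 'rV[R]_(n + n)).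
Variables (T : M -> 'rV[R]_(n + n) -> 'rV[R]_(n + n) -> 'rV[R]_(n + n)).
Hypothesis nabla_chern : chern_connection nabla T.
Variable p : M.
Local Notation J := (Jmx R n).
Implicit Types x y v w : 'rV[R]_(n + n).

Lemma pairingJl (q : M) v w :
  pairing (metric q) (v *m J) w = - pairing (metric q) v (w *m J).
Proof. by rewrite -(metric_J q (v *m J)) mulJJ pairingNl. Qed.

Let X (v : 'rV[R]_(n + n)) : M -> 'rV[R]_(n + n) := coord_field (chart_at p) v.
Let Gamma x v := nabla p x (X v).

Let X_p v : X v p = v. Proof. exact: coord_field_at. Qed.
Let smoothX v : smooth_field p (X v). Proof. exact: smooth_coord_field. Qed.
Let XJ v : X (v *m J) = fun q => X v q *m J.
Proof. by apply/funext => q; exact: coord_fieldJ. Qed.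

Let torsionE x y : T p x y = Gamma x y - Gamma y x.
Proof.
have [_ [[_ _ TE] _]] := nabla_chern.
have := TE p _ _ (smoothX x) (smoothX y).
by rewrite bracket_coord_field subr0 !X_p.
Qed.

Let GammaJr x v : Gamma x (v *m J) = Gamma x v *m J.
Proof. by have [_ [_ [_ nJ _]]] := nabla_chern; rewrite /Gamma XJ nJ. Qed.

Lemma torsion_alt x y : T p y x = - T p x y.
Proof. by rewrite !torsionE opprB. Qed.

Let torsionNl u v : T p (- u) v = - T p u v.
Proof.
have [_ [[Tl _ _] _]] := nabla_chern.
have T0l : T p 0 v = 0.
  by have := Tl p (-1) 0 0 v; rewrite scaler0 addr0 scaleN1r addNr.
by rewrite -scaleN1r -[_ *: u]addr0 Tl T0l addr0 scaleN1r.
Qed.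

(** The real and imaginary parts of T(x - i J x, conj(y - i J y)) = 0. *)
Let torsion_mixed x y :
  T p x y = - T p (x *m J) (y *m J) /\ T p (x *m J) y = T p x (y *m J).
Proof.
have [_ [_ [_ _ T0]]] := nabla_chern.
have := T0 p _ _ (type10_part10 x) (type10_part10 y).
rewrite /part10 /bilin_ext conj_complexify opprK !re_complexify !im_complexify.
rewrite !torsionNl opprK.
by move=> /complexify0[/eqP + /eqP]; rewrite addr_eq0 subr_eq0 => /eqP -> /eqP ->.
Qed.

(** The torsion of two (1,0)-vectors is of type (1,0), because Gamma commutes
    with J in its second argument.  Together with the vanishing of the torsion on
    mixed types this makes T complex bilinear. *)
Lemma torsionJl x y : T p (x *m J) y = T p x y *m J.
Proof.
have [Txy TJ] := torsion_mixed x y.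
apply: (@double_inj R); rewrite {2}TJ -mulmxDl {2}Txy !torsionE !GammaJr.
move: (Gamma (x *m J) y) (Gamma x y) (Gamma y x) (Gamma (y *m J) x) => u v w z.
rewrite opprB !mulmxDl !mulNmx !mulJJ.
by rewrite !opprK addrACA [X in X + _]addrC addrACA [X in _ + X]addrC.
Qed.

Let torsionNr u v : T p u (- v) = - T p u v.
Proof. by rewrite torsion_alt torsionNl -torsion_alt. Qed.

Let torsionJr x y : T p x (y *m J) = T p x y *m J.
Proof. by rewrite torsion_alt torsionJl -mulNmx -torsion_alt. Qed.

Lemma torsion_part10 x y :
  bilin_ext (T p) (part10 x) (part10 y) = part10 (T p x y + T p x y).
Proof.
rewrite /bilin_ext !re_complexify !im_complexify !torsionNl.
rewrite !torsionNr !torsionJl !torsionJr mulJJ !opprK.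
by rewrite /part10 mulmxDl opprD.
Qed.

Let GammaJl x v : Gamma (x *m J) v = Gamma x v *m J.
Proof.
have := torsionJl x v; rewrite !torsionE GammaJr mulmxBl.
by move=> /addIr.
Qed.

(** Below, om is the Kaehler form, and D x v w is the derivative along x of its
    value on the coordinate fields of v and w. *)
Let om (q : M) v w := pairing (metric q) (v *m J) w.

Let D x v w := act p x (fun q => om q (X v q) (X w q)).

Let omC q v w : om q w v = - om q v w.
Proof. by rewrite /om pairingJl metric_sym. Qed.

Let smooth_om v w : smooth_at p (fun q => om q (X v q) (X w q)).
Proof. by have := metric_smooth (smoothX (v *m J)) (smoothX w); rewrite XJ. Qed.

Let DE x v w : D x v w = pairing (metric p) (Gamma x v *m J) w
  + pairing (metric p) (v *m J) (Gamma x w).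
Proof.
have [_ [_ [gE _ _]]] := nabla_chern.
have := gE p x _ _ (smoothX (v *m J)) (smoothX w).
by rewrite -/(Gamma _ _) -/(Gamma _ _) GammaJr !X_p XJ.
Qed.

(** The left-hand side is d omega(x, a, Ja).  By compatibility with the metric each
    term is a sum of two terms in Gamma; as Gamma commutes with J in both
    arguments, those in Gamma(a, a) cancel. *)
Let d_om x a : D x a (a *m J) - D a x (a *m J) + D (a *m J) x a
  = (pairing (metric p) (T p x a) a) *+ 2.
Proof.
rewrite (DE x a) (DE a x) (DE (a *m J) x) (GammaJl a x) (GammaJl a a).
rewrite (GammaJr x a) (GammaJr a a) (mulJJ (Gamma a x)) torsionE.
move: (Gamma x a) (Gamma a x) (Gamma a a) => xa ax aa.
by rewrite !metric_J pairingNl pairingDl pairingNl (metric_sym p a xa); ring.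
Qed.

Let Pf (y0 y1 y2 y3 : 'rV[R]_(n + n)) (q : M) : R :=
  2%:R * (om q (X y0 q) (X y1 q) * om q (X y2 q) (X y3 q)
    - om q (X y0 q) (X y2 q) * om q (X y1 q) (X y3 q)
    + om q (X y0 q) (X y3 q) * om q (X y1 q) (X y2 q)).

Let act_Pf x y0 y1 y2 y3 : act p x (Pf y0 y1 y2 y3) =
  2%:R * (om p y0 y1 * D x y2 y3 + D x y0 y1 * om p y2 y3
    - (om p y0 y2 * D x y1 y3 + D x y0 y2 * om p y1 y3)
    + (om p y0 y3 * D x y1 y2 + D x y0 y3 * om p y1 y2)).
Proof.
set u := chart_map (chart_at p) p.
pose f v w := (fun q => om q (X v q) (X w q)) \o chart_inv (chart_at p).
have df v w : is_derive u x (f v w) (D x v w).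
  apply: DeriveDef => //; apply: diff_derivable.
  exact: smooth_at_differentiable (smooth_om v w).
have fu v w : f v w u = om p v w.
  by rewrite /f /u /= chart_mapK ?X_p //; exact: chart_atP.
have := derive_pfaffian (df y0 y1) (df y2 y3) (df y0 y2) (df y1 y3)
  (df y0 y3) (df y1 y2).
by rewrite !fu.
Qed.

Hypothesis closed_sq : closed_form (@wedge_pow R n M (@kahler_form R n M) 2).

Let wedge_powE (q : M) (v : 'I_(2 * 2) -> 'rV[R]_(n + n)) :
  @wedge_pow R n M (@kahler_form R n M) 2 q v =
  let o k lt_k := v (@Ordinal (2 * 2) k lt_k) in
  2%:R * (om q (o 0 isT) (o 1 isT) * om q (o 2 isT) (o 3 isT)
    - om q (o 0 isT) (o 2 isT) * om q (o 1 isT) (o 3 isT)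
    + om q (o 0 isT) (o 3 isT) * om q (o 1 isT) (o 2 isT)).
Proof. exact: wedge_pow2 (omC q) v. Qed.

Let wedge_pow0 (q : M) (v : 'I_(2 * 2) -> 'rV[R]_(n + n)) r : v r = 0 ->
  @wedge_pow R n M (@kahler_form R n M) 2 q v = 0.
Proof.
move=> vr0; rewrite wedge_powE /=.
have om0l w : om q 0 w = 0 by rewrite /om mul0mx pairing0l.
have om0r w : om q w 0 = 0 by rewrite /om pairing0r.
clearbody om.
have vE k (h h' : (k < 2 * 2)%N) : v (Ordinal h) = v (Ordinal h').
  by congr v; apply/val_inj.
by case: r vr0 => [[|[|[|[|//]]]] lt_r] vr0;
  rewrite (vE _ _ lt_r) vr0 ?om0l ?om0r; ring.
Qed.

(** The exterior derivative of omega^2 on coordinate fields; bump i k is the index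
    of the k-th vector left once the i-th one is removed. *)
Let d_Pf (u : nat -> 'rV[R]_(n + n)) :
  \sum_(i < 5) (-1) ^+ i * act p (u i)
    (Pf (u (bump i 0)) (u (bump i 1)) (u (bump i 2)) (u (bump i 3))) = 0.
Proof.
have := @closed_sq p (fun i => X (u i)) (fun i => smoothX (u i)).
rewrite /ext_der => dW; rewrite -[RHS]dW; apply: eq_bigr => i _.
congr (_ * _); rewrite X_p [X in _ - X]big1 ?subr0.
  congr (act p _ _).
  by apply/funext => q; rewrite wedge_powE.
move=> r _; apply: (@wedge_pow0 _ _ r).
by rewrite eqxx bracket_coord_field.
Qed.

(** Evaluate d(omega^2) on x, a, Ja, b, Jb.  By orthogonality omega vanishes on all
    pairs of these vectors except (a, Ja) and (b, Jb), so what remains is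
    omega(b, Jb) d omega(x, a, Ja) + omega(a, Ja) d omega(x, b, Jb), up to a
    factor. *)
Lemma balanced_trace a b x (g := pairing (metric p)) :
  g a b = 0 -> g a (b *m J) = 0 -> g x a = 0 -> g x (a *m J) = 0 ->
  g x b = 0 -> g x (b *m J) = 0 ->
  g b b * g (T p x a) a + g a a * g (T p x b) b = 0.
Proof.
move=> ab abJ xa xaJ xb xbJ.
have omE v w : om p v w = - g v (w *m J) by rewrite /om pairingJl.
have gNr v w : g v (- w) = - g v w by exact: pairingNr.
have := d_Pf (nth 0 [:: x; a; a *m J; b; b *m J]).
rewrite !big_ord_recl big_ord0 /= /bump /= !act_Pf.
have gJJ v w : g (v *m J) (w *m J) = g v w by exact: metric_J.
have gJl v w : g (v *m J) w = - g v (w *m J) by exact: pairingJl.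
rewrite !omE !mulJJ !gJJ !gNr !gJl ab abJ xa xaJ xb xbJ => dW.
have da := d_om x a; have db := d_om x b.
have -> : g b b * g (T p x a) a + g a a * g (T p x b) b =
    (g b b * (g (T p x a) a *+ 2) + g a a * (g (T p x b) b *+ 2)) / 2 by field.
(* From here on only the linear dependence on the values of D matters. *)
rewrite -da -db; clear DE d_om act_Pf d_Pf da db; clear ab abJ xa xaJ xb xbJ.
clearbody D g; move: (a *m J) (b *m J) dW => aJ bJ.
rewrite !(mul0r, mulr0, oppr0, opprK, subr0, sub0r, addr0, add0r).
move: (D x a aJ) (D a x aJ) (D aJ x a) (D x b bJ) (D b x bJ) (D bJ x b).
move: (g a a) (g b b) => ga gb d1 d2 d3 d4 d5 d6 dW.
by rewrite -[RHS](mul0r 4^-1) -[X in _ = X * _]dW; field.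
Qed.

End Chern.

(** * Unitary frames of type (1,0) *)

Section Frames.
Local Open Scope sesquilinear_scope.
Local Open Scope complex_scope.
Variables (R : realType) (n : nat) (G : 'M[R]_(n + n)).
Local Notation C := R[i].
Local Notation J := (Jmx R n).
Local Notation toC := (map_mx (real_complex R)).
Hypotheses (Gsym : forall u v, pairing G u v = pairing G v u)
  (Gpos : forall v, v != 0 -> 0 < pairing G v v)
  (GJ : forall u v, pairing G (u *m J) (v *m J) = pairing G u v).

Lemma pairing_delta (H : 'M[R]_(n + n)) i j :
  pairing H (delta_mx 0 i) (delta_mx 0 j) = H i j.
Proof. by rewrite /pairing trmx_delta -rowE -colE !mxE. Qed.

Lemma tr_gram : G^T = G.
Proof. by apply/matrixP => i j; rewrite mxE -!pairing_delta Gsym. Qed.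

Lemma gramJ : J *m G *m J^T = G.
Proof.
apply/matrixP => i j; rewrite -[LHS]pairing_delta -[RHS]pairing_delta -GJ.
by rewrite /pairing trmx_mul !mulmxA.
Qed.

Lemma trJ : J^T = - J.
Proof.
by rewrite tr_block_mx opp_block_mx !trmx0 linearN /= trmx1 !oppr0 opprK.
Qed.

Lemma gramCJ : toC J *m toC G *m toC J^T = toC G.
Proof. by rewrite -!map_mxM gramJ. Qed.

(** J is an isometry of the complex bilinear metric and acts on (1,0)-vectors as
    i, whose square is -1. *)
Lemma isotropic10 m p (F : 'M[C]_(m, n + n)) (F' : 'M[C]_(p, n + n)) :
  F *m toC J = 'i *: F -> F' *m toC J = 'i *: F' -> F *m toC G *m F'^T = 0.
Proof.
move=> FJ FJ'; have : F *m toC G *m F'^T = - (F *m toC G *m F'^T).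
  rewrite -{1}gramCJ -map_trmx !mulmxA FJ -[_ *m _ *m F'^T]mulmxA -trmx_mul FJ'.
  by rewrite linearZ /= -scalemxAr -!scalemxAl scalerA -expr2 sqr_i scaleN1r.
exact: (@eq_opp_eq0 C).
Qed.

Definition unitary10 m (F : 'M[C]_(m, n + n)) :=
  F *m toC J = 'i *: F /\ F *m toC G *m F ^t* = 1%:M.

Let conj_toC p q (H : 'M[R]_(p, q)) : map_mx Num.conj (toC H) = toC H.
Proof.
by rewrite -map_mx_comp; apply/matrixP => i j; rewrite !mxE; exact: conjc_real.
Qed.

(** The rows of F and their conjugates are an orthonormal basis P of the
    complexified tangent space; by isotropy a (1,0)-vector has no component on
    the conjugates. *)
Lemma unitary10_complete (F : 'M[C]_(n, n + n)) (z : 'rV[C]_(n + n)) :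
  unitary10 F -> z *m toC J = 'i *: z -> z = z *m toC G *m F ^t* *m F.
Proof.
move=> [FJ FF] zJ; pose P := col_mx F (map_mx Num.conj F).
have FFT := isotropic10 FJ FJ.
have PP : P *m (toC G *m P ^t*) = 1%:M.
  rewrite mulmxA tr_col_mx map_row_mx mul_col_mx mul_col_row scalar_mx_block.
  rewrite map_trmx conj_mxK FF FFT; congr block_mx.
    by rewrite -[X in _ *m X *m _]conj_toC -!conj_mxM FFT map_mx0.
  rewrite -[X in _ *m X *m _]conj_toC -[F^T](conj_mxK) -!conj_mxM FF.
  by rewrite map_mx1.
rewrite -[LHS]mulmx1 -(mulmx1C PP) /P tr_col_mx map_row_mx map_trmx conj_mxK.
rewrite -(mulmxA (toC G)) mul_row_col !mulmxDr !mulmxA -[RHS]addr0; congr (_ + _).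
by rewrite -/(trmx F) isotropic10 ?mul0mx.
Qed.

Lemma gramJC : toC J *m toC G = toC G *m toC J.
Proof.
have JTJ : J^T *m J = 1%:M.
  by rewrite trJ mulNmx -[J *m J]mul1mx mulmxA mulJJ opprK.
by rewrite -{2}gramCJ -[RHS]mulmxA -[X in _ = _ *m X]map_mxM JTJ map_mx1 mulmx1.
Qed.

Lemma exists_orthogonal p (W : 'M[R]_(n + n, p)) : (p < n + n)%N ->
  exists2 x : 'rV_(n + n), x != 0 & x *m W = 0.
Proof.
move=> ltp; have K0 : kermx W != 0.
  rewrite -mxrank_eq0 mxrank_ker subn_eq0 -ltnNge.
  exact: leq_ltn_trans (rank_leq_col W) ltp.
exists (nz_row (kermx W)); first by rewrite nz_row_eq0.
by apply/sub_kermxP; exact: nz_row_sub.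
Qed.

Lemma herm_part10 x y : (part10 x *m toC G *m (part10 y) ^t*) 0 0 =
  (2 * pairing G x y +i* (2 * pairing G x (y *m J)))%C.
Proof.
have -> : (part10 y) ^t* = toC y^T + 'i *: toC (y *m J)^T.
  rewrite part10E -map_mxM linearB linearZ /= !map_trmx conj_mxD.
  by rewrite map_mxN conj_mxZ !conj_toC conjCi scaleNr opprK.
rewrite part10E -map_mxM !mulmxBl !mulmxDr -!scalemxAl -!scalemxAr -!map_mxM.
have := GJ x y; have : pairing G (x *m J) y = - pairing G x (y *m J).
  by rewrite -GJ mulJJ pairingNl.
rewrite /pairing; move: (x *m G *m y^T) (x *m J *m G *m y^T)
  (x *m G *m (y *m J)^T) (x *m J *m G *m (y *m J)^T) => P1 P2 P3 P4.
rewrite !mxE => -> ->.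
by simpc; congr Complex; ring.
Qed.

Let pairing_xxJ x : pairing G x (x *m J) = 0.
Proof.
by apply: (@eq_opp_eq0 R R^o); rewrite {1}Gsym -GJ mulJJ pairingNl.
Qed.

(** One step of Gram-Schmidt.  A real vector x orthogonal to the real and imaginary
    parts of the rows of F exists since 2 m < 2 n; then x - i J x is a nonzero
    (1,0)-vector orthogonal to F. *)
Lemma unitary10_extend m (F : 'M[C]_(m, n + n)) : (m < n)%N -> unitary10 F ->
  exists z : 'rV[C]_(n + n), unitary10 (col_mx z F).
Proof.
move=> ltmn [FJ FF].
pose A := map_mx (@complex.Re R) F; pose B := map_mx (@complex.Im R) F.
have FE : F = toC A + 'i *: toC B by apply/matrixP => i j; rewrite !mxE -complexE.
clearbody A B.
have [|x x0] := @exists_orthogonal _ (G *m row_mx A^T B^T).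
  by rewrite !addnn ltn_double.
rewrite mulmxA mul_mx_row => /eqP; rewrite row_mx_eq0 => /andP[/eqP xA /eqP xB].
have xF : toC x *m toC G *m F ^t* = 0.
  rewrite FE linearD linearZ /= conj_mxD conj_mxZ mulmxDr -scalemxAr.
  by rewrite !map_trmx !conj_toC -!map_mxM xA xB !map_mx0 scaler0 addr0.
have JF : toC J *m F ^t* = 'i *: F ^t*.
  have JT : toC J = - toC J^T by rewrite trJ map_mxN opprK.
  rewrite JT mulNmx -[toC J^T]conj_toC -conj_mxM -map_trmx -trmx_mul FJ.
  by rewrite linearZ /= conj_mxZ -scaleNr conjCi opprK.
set z := part10 x; have zJ : z *m toC J = 'i *: z := type10_part10 x.
have zF : z *m toC G *m F ^t* = 0.
  rewrite /z part10E !mulmxBl -!scalemxAl -(mulmxA (toC x) (toC J)) gramJC.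
  by rewrite (mulmxA (toC x)) -(mulmxA _ (toC J)) JF -scalemxAr xF !scaler0 subr0.
have zz : z *m toC G *m z ^t* = (2 * pairing G x x)%:C%:M.
  by rewrite [LHS]mx11_scalar herm_part10 pairing_xxJ mulr0.
have [|c c1 cC] := @normalizing_factor C (2 * pairing G x x)%:C.
  by rewrite ltcR mulr_gt0 // Gpos.
exists (c *: z); split.
  by rewrite mul_col_mx FJ -scalemxAl zJ scalerA mulrC -scalerA -scale_col_mx.
rewrite tr_col_mx map_row_mx mul_col_mx mul_col_row scalar_mx_block; congr block_mx.
- rewrite linearZ /= conj_mxZ -scalemxAr -!scalemxAl zz scalerA scale_scalar_mx.
  by rewrite [c^* * c]mulrC c1.
- by rewrite -!scalemxAl zF scaler0.
- have -> : F *m toC G *m (c *: z) ^t* = c^* *: (z *m toC G *m F ^t*) ^t*.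
    rewrite linearZ /= conj_mxZ -scalemxAr; congr (_ *: _).
    rewrite !trmx_mul [(toC G)^T]map_trmx tr_gram !conj_mxM conj_toC.
    by rewrite [(F ^t*)^T]map_trmx trmxK conj_mxK mulmxA.
  by rewrite zF trmx0 map_mx0 scaler0.
- exact: FF.
Qed.

Lemma unitary10_exists : exists F : 'M[C]_(n, n + n), unitary10 F.
Proof.
suff H m : (m <= n)%N -> exists F : 'M[C]_(m, n + n), unitary10 F by exact: H.
elim: m => [|m IHm] lemn; first by exists 0; split; apply/matrixP => -[].
have [F UF] := IHm (ltnW lemn); have [z UzF] := unitary10_extend lemn UF.
by exists (col_mx z F).
Qed.

End Frames.

(** * Frames adapted to the torsion *)

Lemma linear_sum (K : pzRingType) (U V : lmodType K) (f : U -> V) (I : finType)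
    (c : I -> K) (x : I -> U) :
  (forall a y z, f (a *: y + z) = a *: f y + f z) ->
  f (\sum_i c i *: x i) = \sum_i c i *: f (x i).
Proof.
move=> f_lin; have f0 : f 0 = 0.
  by have := f_lin (-1) 0 0; rewrite scaler0 addr0 scaleN1r addNr.
by elim/big_rec2: _ => // i y z _ <-; rewrite f_lin.
Qed.

Section BilinExt.
Variables (R : realType) (m : nat) (B : 'rV[R]_m -> 'rV[R]_m -> 'rV[R]_m).
Hypotheses (Bl : forall c x y z, B (c *: x + y) z = c *: B x z + B y z)
  (Br : forall c x y z, B z (c *: x + y) = c *: B z x + B z y).

Let re_lin (c : R[i]) (x y : 'rV[R[i]]_m) : re_part (c *: x + y) =
  complex.Re c *: re_part x + (- complex.Im c *: im_part x + re_part y).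
Proof.
apply/rowP => k; rewrite !mxE.
by case: c (x 0 k) (y 0 k) => [a b] [a1 b1] [a2 b2] /=; ring.
Qed.

Let im_lin (c : R[i]) (x y : 'rV[R[i]]_m) : im_part (c *: x + y) =
  complex.Re c *: im_part x + (complex.Im c *: re_part x + im_part y).
Proof.
apply/rowP => k; rewrite !mxE.
by case: c (x 0 k) (y 0 k) => [a b] [a1 b1] [a2 b2] /=; ring.
Qed.

Lemma bilin_extl c x y z :
  bilin_ext B (c *: x + y) z = c *: bilin_ext B x z + bilin_ext B y z.
Proof.
rewrite /bilin_ext re_lin im_lin !Bl; apply/rowP => k; rewrite !mxE.
by case: c => a b; simpc; congr Complex; rewrite /=; ring.
Qed.

Lemma bilin_extr c x y z :
  bilin_ext B z (c *: x + y) = c *: bilin_ext B z x + bilin_ext B z y.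
Proof.
rewrite /bilin_ext re_lin im_lin !Br; apply/rowP => k; rewrite !mxE.
by case: c => a b; simpc; congr Complex; rewrite /=; ring.
Qed.

End BilinExt.

Section Adapted.
Local Open Scope sesquilinear_scope.
Local Open Scope complex_scope.
Variables (R : realType) (M : hermitian_manifold R 3).
Variables (nabla : M -> 'rV[R]_(3 + 3) -> (M -> 'rV[R]_(3 + 3)) -> 'rV[R]_(3 + 3)).
Variables (T : M -> 'rV[R]_(3 + 3) -> 'rV[R]_(3 + 3) -> 'rV[R]_(3 + 3)).
Hypotheses (M_balanced : balanced M) (nabla_chern : chern_connection nabla T).
Variable q : M.
Local Notation J := (Jmx R 3).
Local Notation toC := (map_mx (real_complex R)).
Local Notation G := (metric q).

Let symG := metric_sym q.
Let posG := metric_pos q.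
Let GJ := metric_J q.

(** The component T^j_(ik) in the frame formed by the rows of F, when it is unitary. *)
Definition component (F : 'M[R[i]]_(3, 3 + 3)) (j i k : 'I_3) : R[i] :=
  (bilin_ext (T q) (row i F) (row k F) *m toC G *m F ^t*) 0 j.

Lemma torsion_row10 (F : 'M[R[i]]_(3, 3 + 3)) i k : F *m toC J = 'i *: F ->
  bilin_ext (T q) (row i F) (row k F) =
  let a i := re_part (row i F) in part10 (T q (a i) (a k) + T q (a i) (a k)).
Proof.
by move=> FJ; rewrite /= -(torsion_part10 nabla_chern) -!row_part10.
Qed.

Lemma componentE F i k : unitary10 G F ->
  bilin_ext (T q) (row i F) (row k F) = \sum_j component F j i k *: row j F.
Proof.
move=> UF; rewrite -mulmx_sum_row -unitary10_complete // torsion_row10 ?UF.1 //.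
exact: type10_part10.
Qed.

Lemma component_alt F j i k : F *m toC J = 'i *: F ->
  component F j k i = - component F j i k.
Proof.
move=> FJ; rewrite /component !torsion_row10 //= (torsion_alt nabla_chern).
set x := T q _ _; rewrite -opprD.
have -> : part10 (- (x + x)) = - part10 (x + x).
  by rewrite /part10 mulNmx; apply/rowP => l; rewrite !mxE; simpc.
by rewrite !mulNmx mxE.
Qed.

(** If a_i is the real part of the frame vector e_i, the real and imaginary parts of
    the trace are multiples of sum_i <T(x, a_i), a_i> for x = a_k and x = J a_k.
    The term i = k vanishes, and [balanced_trace] says that the other two cancel. *)
Lemma component_trace F k : unitary10 G F -> \sum_i component F i i k = 0.
Proof.
move=> UF; have [FJ FF] := UF; pose a i := re_part (row i F).
have row10 l : row l F = part10 (a l) by exact: row_part10.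
have herm (w : 'rV[R[i]]_(3 + 3)) j :
    (w *m toC G *m F ^t*) 0 j = (w *m toC G *m (row j F) ^t*) 0 0.
  by rewrite mxE [RHS]mxE; apply: eq_bigr => l _; rewrite !mxE.
pose g := pairing G.
have aa i j : g (a i) (a j) = (i == j)%:R / 2 /\ g (a i) (a j *m J) = 0.
  have : (F *m toC G *m F ^t*) i j = (i == j)%:R by rewrite FF mxE.
  have -> : (F *m toC G *m F ^t*) i j = (row i F *m toC G *m F ^t*) 0 j.
    by rewrite -!row_mul [RHS]mxE.
  rewrite herm !row10 herm_part10 // -(rmorph_nat (real_complex R)).
  move=> [<- gJ]; split; first by rewrite /g; field.
  by apply: (mulfI (x := 2)); rewrite ?mulr0 // pnatr_eq0.
have T_xx x : T q x x = 0.
  by apply: (@eq_opp_eq0 R); exact: (torsion_alt nabla_chern q x x).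
have g0 v : g 0 v = 0 by exact: pairing0l.
have gJl x y : g (x *m J) y = - g x (y *m J) by rewrite /g pairingJl.
have sum0 x : x = a k \/ x = a k *m J -> \sum_i g (T q x (a i)) (a i) = 0.
  move=> xk; have Tk : T q x (a k) = 0.
    by case: xk => ->; rewrite ?(torsionJl nabla_chern) T_xx ?mul0mx.
  have orth i : i != k -> g x (a i) = 0 /\ g x (a i *m J) = 0.
    rewrite eq_sym => /negbTE ki; have [ki0 kiJ] := aa k i.
    rewrite ki mul0r in ki0; case: xk => ->; first by [].
    by rewrite !gJl mulJJ /g pairingNr -/g ki0 kiJ !oppr0.
  have two_terms i m : i != m -> i != k -> m != k ->
      g (T q x (a i)) (a i) + g (T q x (a m)) (a m) = 0.
    move=> /negbTE im ik mk.
    have [xi xiJ] := orth i ik; have [xm xmJ] := orth m mk.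
    have [iiE _] := aa i i; have [mmE _] := aa m m; have [imE imJ] := aa i m.
    rewrite im mul0r in imE.
    have := balanced_trace nabla_chern M_balanced imE imJ xi xiJ xm xmJ.
    rewrite -!/(g _ _) iiE mmE !eqxx -mulrDr => /eqP.
    by rewrite !mulf_eq0 invr_eq0 !pnatr_eq0 /= => /eqP.
  clear orth xk; rewrite sum3; move: k Tk two_terms; elim/ord3P => -> two_terms;
    by rewrite g0 ?add0r ?addr0 two_terms.
have compE i : component F i i k = Complex
    (- 4 * g (T q (a k) (a i)) (a i)) (4 * g (T q (a k *m J) (a i)) (a i)).
  rewrite /component torsion_row10 // herm row10 herm_part10 //= -/(a i) -/(a k).
  rewrite (torsion_alt nabla_chern q (a k)) (torsionJl nabla_chern) gJl.
  rewrite -!/(g _ _) /g !pairingDl !pairingNl.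
  by congr Complex; ring.
rewrite (eq_bigr _ (fun i _ => compE i)).
transitivity (Complex (- 4 * \sum_i g (T q (a k) (a i)) (a i))
  (4 * \sum_i g (T q (a k *m J) (a i)) (a i))).
  by rewrite !sum3; simpc; congr Complex; ring.
by rewrite !sum0 ?mulr0; [|right|left].
Qed.

Lemma adapted_frame : exists2 F, unitary10 G F &
  forall j k, component F j j k = 0.
Proof.
have [F UF] := unitary10_exists symG posG GJ; have [FJ FF] := UF.
have [U UU Ut] := diagonal_torsion (fun j i k => component_alt j i k FJ)
  (fun k => component_trace k UF).
have UFE : (U *m F) ^t* = F ^t* *m U ^t* by rewrite trmx_mul conj_mxM.
have UUF : unitary10 G (U *m F).
  split; first by rewrite -mulmxA FJ scalemxAr.
  rewrite UFE !mulmxA -[U *m F *m toC G](mulmxA U) -(mulmxA U _ (F ^t*)) FF.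
  by rewrite mulmx1.
exists (U *m F) => // j k; rewrite -[RHS](Ut j k).
have [_ [[Tl Tr _] _]] := nabla_chern.
have rowE i : row i (U *m F) = \sum_a U i a *: row a F.
  by rewrite row_mul mulmx_sum_row; apply: eq_bigr => a _; rewrite mxE.
rewrite {1}/component !rowE UFE mulmxA.
rewrite (linear_sum (f := fun z => bilin_ext (T q) z _)) => [|a x y]; last first.
  exact: bilin_extl (Tl q) _ _ _ _.
rewrite !mulmx_suml summxE; apply: eq_bigr => a _.
rewrite (linear_sum (f := fun z => bilin_ext (T q) _ z)) => [|b x y]; last first.
  exact: bilin_extr (Tr q) _ _ _ _.
rewrite scaler_sumr !mulmx_suml summxE; apply: eq_bigr => b _.
rewrite scalerA -!scalemxAl mxE [X in _ * X]mxE big_distrr /=.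
apply: eq_bigr => m _; rewrite !mulrA /component; congr (_ * _).
by rewrite mxE mxE.
Qed.

End Adapted.

Theorem proposition2 (R : realType) (M : hermitian_manifold R 3)
    (nabla : M -> 'rV[R]_(3 + 3) -> (M -> 'rV[R]_(3 + 3)) -> 'rV[R]_(3 + 3))
    (T : M -> 'rV[R]_(3 + 3) -> 'rV[R]_(3 + 3) -> 'rV[R]_(3 + 3))
    (M_balanced : balanced M) (nabla_chern : chern_connection nabla T) (p : M) :
  exists (U : set M) (e : M -> 'I_3 -> 'rV[R[i]]_(3 + 3))
         (t : M -> 'I_3 -> 'I_3 -> 'I_3 -> R[i]),
    [/\ open_nbhs p U,
        unitary_frame U e,
        torsion_components T U e t &
        forall q, U q -> forall j k : 'I_3, t q j j k = 0].
Proof.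
have /boolp.choice [F UF] : forall q : M, exists F : 'M[R[i]]_(3, 3 + 3),
    unitary10 (metric q) F /\ forall j k, component T q F j j k = 0.
  by move=> q; have [F] := adapted_frame M_balanced nabla_chern q; exists F.
exists setT, (fun q i => row i (F q)), (fun q => component T q (F q)).
split => [|q _|q _ i k|q _].
- by split => //; exact: openT.
- have [[FJ FF] _] := UF q; split=> [i|i j].
    by rewrite /type10 -row_mul FJ linearZ.
  transitivity ((F q *m map_mx (real_complex R) (metric q) *m
    map_mx Num.conj (F q)^T) i j).
    rewrite /metricC /pairing -!row_mul mxE mxE [RHS]mxE; apply: eq_bigr => l _.
    by rewrite !mxE.
  by rewrite FF mxE.
- by apply: componentE (UF q).1; exact: nabla_chern.
- exact: (UF q).2.
Qed.
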